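(* For every fixed integer $r\ge 3$, almost all $r$-regular graphs have conflict-free connection number $2$; that is, the number of $r$-regular graphs on $n$ labeled vertices $G$ with $cfc(G)=2$, divided by the number of all $r$-regular graphs on these $n$ labeled vertices, tends to $1$ as $n\to\infty$.
   Context: For a connected graph $G$ with an edge-coloring (adjacent edges may share colors), a path is conflict-free if some color appears on exactly one of its edges; the coloring is a conflict-free connection coloring if every two distinct vertices are joined by a conflict-free path. The conflict-free connection number $cfc(G)$ is the minimum number of colors in such a coloring. *)

(* Defs.v *)
From HB Require Import structures.
From mathcomp Require Import all_boot all_order all_algebra.
From mathcomp Require Import all_classical all_reals all_analysis.

Set Implicit Arguments.
Unset Strict Implicit.
Unset Printing Implicit Defensive.

Local Open Scope nat_scope.

(* A simple graph on the vertex set T is given by its edge set, a set of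
   2-element subsets of T; this encoding is one-to-one on labeled graphs. *)
Definition simple_graph (T : finType) (E : {set {set T}}) : bool :=
  [forall e in E, #|e| == 2].

Definition adj (T : finType) (E : {set {set T}}) : rel T :=
  fun x y => [set x; y]%SET \in E.

Definition regular (T : finType) (r : nat) (E : {set {set T}}) : bool :=
  [forall x, #|[set y | adj E x y]%SET| == r].

Definition connected_graph (T : finType) (E : {set {set T}}) : bool :=
  [forall x, forall y, connect (adj E) x y].

(* As in path.v, a path is given by its first vertex x and the sequence p of
   the following ones; paths do not repeat vertices. *)
Definition path_between (T : finType) (E : {set {set T}}) (x y : T)
    (p : seq T) : Prop :=
  [/\ path (adj E) x p, last x p = y & uniq (x :: p)].

Definition path_edges (T : finType) (x : T) (p : seq T) : seq {set T} :=
  pairmap (fun u v => [set u; v]%SET) x p.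

Definition conflict_free (T : finType) (c : {set T} -> nat) (x : T)
    (p : seq T) : Prop :=
  exists a : nat, count (fun e => c e == a) (path_edges x p) = 1.

(* Colors are natural numbers; only the values of c on edges matter. *)
Definition cf_connection_coloring (T : finType) (E : {set {set T}})
    (c : {set T} -> nat) : Prop :=
  forall x y : T, x != y ->
    exists p : seq T, path_between E x y p /\ conflict_free c x p.

Definition cf_colorable (T : finType) (E : {set {set T}}) (k : nat) : Prop :=
  exists c : {set T} -> nat,
    (forall e, e \in E -> c e < k) /\ cf_connection_coloring E c.

(* The minimum exists for every connected graph (give distinct colors to all
   edges); for a disconnected one no k qualifies and the value is 0. *)
Definition cfc (T : finType) (E : {set {set T}}) : nat :=
  xget 0 [set k | cf_colorable E k /\ forall j, cf_colorable E j -> k <= j]%classic.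

Definition regular_graphs (r n : nat) : {set {set {set 'I_n}}} :=
  [set E : {set {set 'I_n}} | simple_graph E && regular r E]%SET.

Definition regular_graphs_cfc2 (r n : nat) : {set {set {set 'I_n}}} :=
  [set E in regular_graphs r n | connected_graph E && (cfc E == 2)]%SET.

(* Main.v *)
Require Import Defs.
From HB Require Import structures.
From mathcomp Require Import all_boot all_order all_algebra.
From mathcomp Require Import all_classical all_reals all_analysis.
From mathcomp Require Import finset all_fingroup zify.

(** Colour one edge of a 2-connected graph with 1 and the others with 0: any two
    distinct vertices are joined by a path through that edge, so two colours
    suffice; one colour suffices only for complete graphs. It remains to see that
    almost all r-regular graphs are 2-connected.

    An r-regular graph comes from exactly (r!)^n perfect matchings of the set of
    its r n half-edges. A positive proportion of all perfect matchings gives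
    simple graphs: the expected number of defects (half-edges in loops or in
    multiple edges) is bounded, so half of the matchings have at most K defects
    by Markov's inequality, and switching two pairs shows that the number of
    matchings with k + 1 <= K defects is at most a constant times the number of
    those with at most k defects. If v separates S from the rest of the graph,
    then r |S| + d half-edges are matched among themselves, with d <= r; the
    proportion of such matchings, summed over the S of size s >= r and over v, is
    O(1/n) for s = 3, 4 and O(1/n^2) for each s >= 5, hence O(1/n) altogether. *)

Set Implicit Arguments.
Unset Strict Implicit.
Unset Printing Implicit Defensive.
Local Open Scope set_scope.
Local Open Scope nat_scope.

(** * Colouring 2-connected graphs *)

Section TwoConnected.
Variables (T : finType) (E : {set {set T}}).
Implicit Types (x y u v : T) (p q : seq T).

Definition avoiding v : rel T := fun x y => [&& adj E x y, x != v & y != v].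

(** Deleting one vertex never disconnects the rest. Connectedness of [E] itself follows once there
    are three vertices. *)
Definition two_connected : Prop :=
  forall v x y, x != v -> y != v -> connect (avoiding v) x y.

Lemma adjC x y : adj E x y = adj E y x.
Proof. by rewrite /adj setUC. Qed.

Lemma path_avoiding v x p :
  path (avoiding v) x p -> path (adj E) x p /\ v \notin p.
Proof.
elim: p x => [|y p IHp] x //= /andP[/and3P[-> _ yv] /IHp[-> vp]].
by rewrite inE eq_sym negb_or yv vp.
Qed.

Lemma two_connected_path v x y : two_connected -> x != v -> y != v ->
  exists p, [/\ path (adj E) x p, last x p = y & v \notin x :: p].
Proof.
move=> E2 xv yv; case/connectP: (E2 v x y xv yv) => p /path_avoiding[xp vp] ->.
by exists p; split=> //; rewrite inE eq_sym negb_or xv.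
Qed.

(** Two disjoint walks, from [x] to [u] and from [y] to [v]. Repetitions inside each are allowed;
    [shortenP] removes them where simple paths matter. *)
Definition linked u v x y : Prop := exists p q,
  [/\ path (adj E) x p /\ last x p = u, path (adj E) y q /\ last y q = v
    & forall z, z \in x :: p -> z \in y :: q -> False].

(* If y lies on the path P from x to u, then u can be reached from y along P,
   and it remains to follow a path R from x avoiding y up to the first point
   where it meets the end of P or the other path. *)
Lemma linked_step u v x y y' : two_connected -> x != y -> adj E y y' ->
  linked u v x y' -> linked u v x y \/ linked v u x y.
Proof.
move=> E2 xy yy' [p0 [q [[xp0 lp0] [y'q lq] disj0]]].
move: lp0 disj0; case/shortenP: xp0 => p xp Up sub_p lp disj0.
have disj z : z \in x :: p -> z \in y' :: q -> False.
  move=> zp; apply: disj0; move: zp; rewrite !inE.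
  by case/orP=> [->//|/sub_p->]; rewrite orbT.
have [yp|yp] := boolP (y \in x :: p); last first.
  left; exists p, (y' :: q); split; rewrite /= ?yy' //.
  move=> z zp; rewrite inE => /orP[/eqP zy|]; first by rewrite -zy zp in yp.
  exact: disj.
have vq : v \in y' :: q by rewrite -lq mem_last.
have vy : v != y by apply: contraTneq vq => ->; apply/negP; apply: disj.
have {}yp : y \in p by move: yp; rewrite inE eq_sym (negPf xy).
case/splitPr: yp xp Up lp disj {sub_p disj0} => p1 p2.
rewrite cat_path last_cat /= => /and3P[xp1 ay yp2].
rewrite mem_cat cat_uniq inE /= !negb_or => /and3P[/and3P[xp1' xy' xp2]].
move=> _ /and3P[_ yp2' Up2] lp disj.
have [r [xr lr yr]] := two_connected_path E2 xy vy.
pose B := mem (p2 ++ y' :: q).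
have hasB : has B r.
  case: r xr lr yr => [|z r] xr lr yr.
    by case: (disj x); rewrite ?mem_head //; move: lr => /= ->.
  apply/hasP; exists v; first by rewrite -lr /= mem_last.
  by rewrite /B /= mem_cat vq orbT.
case/split_find: hasB xr yr {lr} => z s1 s2 Bz s1B xr yr.
have [xs {}yr] : path (adj E) x (rcons s1 z) /\ y \notin x :: rcons s1 z.
  move: xr yr; rewrite cat_path -cat_cons mem_cat negb_or.
  by case/andP=> -> _ /andP[->].
have out_s w : w \in x :: s1 -> w \notin p2 ++ y' :: q.
  rewrite inE => /orP[/eqP->|ws]; last by exact: (hasPn s1B).
  rewrite mem_cat negb_or xp2; apply/negP; apply: disj; exact: mem_head.
have in_xs w : w \in x :: rcons s1 z -> (w \in x :: s1) \/ w = z.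
  rewrite inE mem_rcons !inE => /or3P[->|/eqP->|->]; rewrite ?orbT; auto.
(* [z] is the first point of [r] on [p2] or on [y' :: q]. In the latter case the targets swap: [x]
   continues along [q] to [v], and [y] follows [p2] to [u]. Otherwise [x] joins [p2] towards [u],
   and [y] steps to [y']. *)
have [zq|zq] := boolP (z \in y' :: q).
  right.
  have [q2 [zq2 lq2 sq2]] : exists q2, [/\ path (adj E) z q2, last z q2 = v &
      {subset q2 <= y' :: q}].
    move: zq; rewrite inE => /orP[/eqP->|zq].
      by exists q; split=> // w wq; rewrite inE wq orbT.
    case/splitPr: zq y'q lq {disj vq B Bz s1B out_s} => q1 q2.
    rewrite cat_path last_cat /= => /and3P[_ _ zq2 lq2].
    by exists q2; split=> // w wq; rewrite !(inE, mem_cat) wq !orbT.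
  exists (rcons s1 z ++ q2), p2; split; rewrite ?cat_path ?last_cat ?last_rcons.
  - by rewrite xs.
  - by [].
  move=> w; rewrite -cat_cons mem_cat => w1 w2.
  have [wq|wq] := boolP (w \in y' :: q).
    by apply: (disj w) => //; rewrite !(inE, mem_cat) -[_ || (w \in p2)]in_cons w2 !orbT.
  case/orP: w1 => [w1|/sq2]; last by apply/negP.
  move: w2; rewrite inE => /orP[/eqP wy|w2]; first by rewrite -wy w1 in yr.
  case: (in_xs _ w1) => [/out_s|wz]; first by rewrite mem_cat w2.
  by move: wq; rewrite wz zq.
have zp2 : z \in p2 by move: Bz; rewrite /B /= mem_cat (negPf zq) orbF.
left.
case/splitPr: zp2 lp yp2 yp2' disj out_s {Up2 B Bz s1B xp2} => p3 p4.
rewrite last_cat cat_path /= => lp /and3P[_ _ zp4] yp2' disj out_s.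
exists (rcons s1 z ++ p4), (y' :: q).
split; rewrite ?cat_path ?last_cat ?last_rcons /= ?yy' //.
  by rewrite xs.
move=> w; rewrite -cat_cons mem_cat => w1 w2.
have [w4|w4] := boolP (w \in z :: p4).
  move: w2; rewrite inE => /orP[/eqP wy|w2].
    by move: yp2'; rewrite mem_cat negb_or -wy w4 andbF.
  by apply: (disj w) => //; rewrite inE mem_cat inE mem_cat w4 !orbT.
move: w4; rewrite inE negb_or => /andP[wz w4].
move: w1; rewrite (negPf w4) orbF => w1.
move: w2; rewrite inE => /orP[/eqP wy|w2]; first by rewrite -wy w1 in yr.
case: (in_xs _ w1) => [/out_s|]; first by rewrite mem_cat w2 orbT.
by move/eqP; rewrite (negPf wz).
Qed.

(** Menger's theorem for two pairs, up to exchanging [u] and [v]: start at [v] and move back to [y]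
    along a path avoiding [x], one [linked_step] per edge. *)
Lemma two_connected_linked u v x y : two_connected -> u != v -> x != y ->
  linked u v x y \/ linked v u x y.
Proof.
move=> E2 uv xy.
have end_linked u' v' z : u' != v' -> z != u' -> linked u' v' u' z.
  move=> u'v' zu'.
  have [|p [zp lp u'p]] := @two_connected_path u' z v' E2 zu'.
    by rewrite eq_sym.
  by exists [::], p; split=> // w; rewrite inE => /eqP-> wp; rewrite wp in u'p.
have [xu|xu] := eqVneq x u.
  by left; rewrite xu; apply: end_linked; rewrite // -xu eq_sym.
have [xv|xv] := eqVneq x v.
  by right; rewrite xv; apply: end_linked; rewrite 1?eq_sym // -xv.
have [||q [yq lq xq]] := @two_connected_path x y v E2; rewrite 1?eq_sym //.
elim: q y yq lq xq xy => [|y' q IHq] y /=.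
  move=> _ -> _ _; left.
  have [p [xp lp vp]] := @two_connected_path v x u E2 xv uv.
  by exists p, [::]; split=> // w wp; rewrite inE => /eqP wv; rewrite -wv wp in vp.
move=> /andP[ay yq] lq; rewrite inE negb_or => /andP[_ xq] xy.
have xy' : x != y' by move: xq; rewrite inE negb_or => /andP[].
case: (IHq y') => // L; have := linked_step E2 xy ay L; tauto.
Qed.

Lemma path_rev x p : path (adj E) x p ->
  path (adj E) (last x p) (rev (belast x p)).
Proof.
rewrite rev_path; congr path.
by apply/funext=> a; apply/funext=> b; rewrite adjC.
Qed.

(** The edge joins the two disjoint paths of [two_connected_linked], the second one reversed;
    disjointness makes the result simple. *)
Lemma path_through_edge u v x y : two_connected -> u != v -> adj E u v ->
  x != y -> exists p1 p2 w, [/\ path_between E x y (p1 ++ w :: p2)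
    & [set last x p1; w] = [set u; v]].
Proof.
move=> E2 uv auv xy.
suff through u' v' : adj E u' v' -> [set u'; v'] = [set u; v] ->
    linked u' v' x y ->
  exists p1 p2 w, [/\ path_between E x y (p1 ++ w :: p2)
    & [set last x p1; w] = [set u; v]].
  case: (two_connected_linked E2 uv xy) => [/through|/through]; first exact.
  by apply; rewrite 1?adjC // setUC.
move=> au'v' eq_uv [p0 [q0 [[xp0 lp0] [yq0 lq0] disj0]]].
move: lp0 lq0 disj0; case/shortenP: xp0 => p xp Up sub_p lp.
case/shortenP: yq0 => q yq Uq sub_q lq disj.
exists p, (rev (belast y q)), v'; split; last by rewrite lp.
have vE : v' :: rev (belast y q) = rev (y :: q).
  by rewrite [y :: q]lastI lq rev_rcons.
split.
- by rewrite cat_path xp /= lp au'v' -lq path_rev.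
- by rewrite last_cat vE rev_cons last_rcons.
rewrite vE -cat_cons cat_uniq Up rev_uniq Uq andbT /=.
apply/hasPn => w; rewrite mem_rev => wq; apply/negP => wp.
apply: (disj w).
  by move: wp; rewrite !inE => /orP[->//|/sub_p->]; rewrite orbT.
by move: wq; rewrite !inE => /orP[->//|/sub_q->]; rewrite orbT.
Qed.

Lemma path_edges_sub x p e z :
  e \in path_edges x p -> z \in e -> z \in x :: p.
Proof.
elim: p x => [|y p IHp] x //=; rewrite inE => /orP[/eqP->|/IHp ze /ze].
  by rewrite !inE orbA => ->.
by rewrite [z \in x :: _]inE => ->; rewrite orbT.
Qed.

Lemma two_connected_colorable u v : two_connected -> u != v -> adj E u v ->
  cf_colorable E 2.
Proof.
move=> E2 uv auv; exists (fun e => e == [set u; v] : nat); split=> [e _|x y xy].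
  by case: eqP.
have [p1 [p2 [w [xpy euv]]]] := path_through_edge E2 uv auv xy.
exists (p1 ++ w :: p2); split=> //; exists 1.
(* The edge is used once: an earlier use would repeat [w], a later one [last x p1]. *)
have [_ _] := xpy; rewrite -cat_cons cat_uniq => /and3P[_ disj Uw].
rewrite (eq_count (a2 := pred1 [set u; v])); last by move=> e /=; rewrite eqb1.
rewrite /path_edges pairmap_cat count_cat /= euv eqxx -/(path_edges _ _).
rewrite -/(path_edges _ _) !(count_memPn _) //.
- apply/negP=> /path_edges_sub-/(_ (last x p1)).
  rewrite -euv !inE eqxx => /(_ isT); rewrite -in_cons => lw.
  by case/hasP: disj; exists (last x p1); rewrite ?mem_last.
- apply/negP=> /path_edges_sub-/(_ w); rewrite -euv !inE eqxx orbT => /(_ isT).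
  by rewrite -in_cons => lw; case/hasP: disj; exists w; rewrite ?mem_head.
Qed.

(** With at most one colour, a conflict-free path is a single edge, which cannot join [v] to [w]. *)
Lemma cf_colorable_lt2 u v w k : adj E u v -> v != w -> ~~ adj E v w ->
  cf_colorable E k -> 1 < k.
Proof.
move=> auv vw avw [c [c_lt cf]]; rewrite ltnNge; apply/negP=> k1.
have c0 e : e \in E -> c e = 0 by move/c_lt => /leq_trans/(_ k1); case: (c e).
have path0 x p : path (adj E) x p -> all (fun e => c e == 0) (path_edges x p).
  by elim: p x => //= y p IHp x /andP[axy /IHp->]; rewrite c0.
have [p [[vp lp _] [a ca]]] := cf v w vw.
have : size p = 1.
  rewrite -(size_pairmap (fun u w => [set u; w]) v p) -/(path_edges v p).
  have [a0|a0] := eqVneq a 0.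
    by rewrite -ca a0; apply/esym/eqP; rewrite -all_count; exact: path0.
  move: ca; rewrite (_ : count _ _ = 0) //.
  apply/eqP; rewrite -leqn0 leqNgt -has_count; apply/hasPn => e.
  by move/(allP (path0 _ _ vp)) => /eqP->; rewrite eq_sym.
case: p vp lp {ca} => [|z [|? ?]] //= /andP[avz _] zw _.
by rewrite -zw avz in avw.
Qed.

Lemma cfc_two_connected u v w : two_connected -> u != v -> adj E u v ->
  v != w -> ~~ adj E v w -> cfc E = 2.
Proof.
move=> E2 uv auv vw avw; apply: xget_unique; first split.
- exact: two_connected_colorable uv auv.
- by move=> j; apply: cf_colorable_lt2 auv vw avw.
move=> k [k_col k_min]; apply/eqP; rewrite eqn_leq.
rewrite (cf_colorable_lt2 auv vw avw k_col) k_min //.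
exact: two_connected_colorable uv auv.
Qed.

(** Makes [S] a union of components of the graph without [v]; the empty set and the set of all
    vertices but [v] qualify. *)
Definition separates (S : {set T}) v : bool :=
  (v \notin S) && [forall x in S, forall y, adj E x y ==> (y \in v |: S)].

(** The vertices reachable from [x] without passing through [v] form a set separated by [v]; it
    contains [x], so it is everything but [v]. *)
Lemma two_connected_no_separation :
  (forall S v, separates S v -> S = set0 \/ v |: S = setT) -> two_connected.
Proof.
move=> nosep v x y xv yv; pose S := [set z | connect (avoiding v) x z].
have avoidS z : z \in S -> z != v.
  rewrite inE => /connectP[p xp ->]; move: (path_avoiding xp) => [_ vp].
  by apply: contraNneq vp; case: p {xp} => [/= /eqP|z' p /= <-];
    rewrite ?(negPf xv) ?mem_last.
have /nosep[S0|ST] : separates S v.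
  rewrite /separates; apply/andP; split.
    by apply/negP=> /avoidS; rewrite eqxx.
  apply/forall_inP=> a aS; apply/forallP=> b; apply/implyP=> ab.
  rewrite !inE; have [//|/= bv] := eqVneq b v.
  move: (aS); rewrite inE => xa; apply: connect_trans xa (connect1 _).
  by rewrite /avoiding ab bv avoidS.
- by move: (in_set0 x); rewrite -S0 inE connect0.
- by move: (in_setT y); rewrite -ST !inE (negPf yv).
Qed.

Lemma two_connected_connected : 2 < #|T| -> two_connected -> connected_graph E.
Proof.
move=> T3 E2; apply/forallP=> x; apply/forallP=> y.
have [v] : exists v, v \notin [set x; y].
  apply/existsP; rewrite -negb_forall; apply: contraL T3 => /forallP xyT.
  rewrite -leqNgt -cardsT; apply: leq_trans (_ : #|[set x; y]| <= 2).
    by apply/subset_leq_card/fintype.subsetP=> z _; apply: xyT.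
  by rewrite cards2; case: eqP.
rewrite !inE negb_or => /andP[vx vy].
have [||p [xp <- _]] := @two_connected_path v x y E2; rewrite 1?eq_sym //.
by apply/connectP; exists p.
Qed.

End TwoConnected.

(** * Perfect matchings *)

(* The number of perfect matchings of an n-set: (n - 1)!! for n even, 0 for n odd. *)
Fixpoint dfact (n : nat) : nat := if n is m.+2 then m.+1 * dfact m else (n == 0).

Section Matchings.
Variable D : finType.
Implicit Types (f : {perm D}) (A W : {set D}).

(* A perfect matching of A is encoded as the involution of D exchanging the
   points of each pair and fixing the points outside A. *)
Definition matchings A : {set {perm D}} :=
  [set f : {perm D} | [forall x, f (f x) == x] && ([set x | f x != x] == A)].

Lemma matchingsP f A :
  reflect ((forall x, f (f x) = x) /\ (forall x, (x \in A) = (f x != x)))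
          (f \in matchings A).
Proof.
rewrite inE; apply: (iffP andP) => [[/forallP ff /eqP fA]|[ff fA]]; split.
- by move=> x; apply/eqP.
- by move=> x; rewrite -fA inE.
- by apply/forallP=> x; rewrite ff.
- by apply/eqP/setP=> x; rewrite inE fA.
Qed.

(** Composing with the transposition of two partners makes both fixed, which deletes their pair;
    composing again restores it. *)
Lemma matching_remove_pair f A a b : a \in A -> b \in A -> a != b ->
  (f \in matchings A) && (f a == b)
    = ((tperm a b * f)%g \in matchings (A :\ a :\ b)).
Proof.
move=> aA bA ab; apply/andP/matchingsP => [[/matchingsP[ff fA] /eqP fab]|[ff fA]].
  have fba : f b = a by rewrite -fab ff.
  have gE x : (tperm a b * f)%g x = if (x == a) || (x == b) then x else f x.
    rewrite permM; case: tpermP => [->|->|/eqP/negPf-> /eqP/negPf->] //=.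
      by rewrite fba eqxx.
    by rewrite fab eqxx orbT.
  split=> x; rewrite !gE.
    have [xab|] := boolP ((x == a) || (x == b)); first by rewrite xab.
    rewrite negb_or => /andP[xa xb].
    have fxa : (f x == a) = (x == b) by rewrite -fba (inj_eq perm_inj).
    have fxb : (f x == b) = (x == a) by rewrite -fab (inj_eq perm_inj).
    by rewrite fxa fxb (negPf xa) (negPf xb) ff.
  rewrite !inE fA; case: eqVneq => [->|xb]; first by rewrite orbT eqxx.
  by case: (eqVneq x a) => [->|xa] /=; rewrite ?eqxx.
have ga : (tperm a b * f)%g a = a.
  by apply/eqP; rewrite -[_ == _]negbK -fA !inE eqxx andbF.
have gb : (tperm a b * f)%g b = b.
  by apply/eqP; rewrite -[_ == _]negbK -fA !inE eqxx.
have fE x : f x = (tperm a b * f)%g (tperm a b x) by rewrite permM tpermK.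
have fab : f a = b by rewrite fE tpermL gb.
have fba : f b = a by rewrite fE tpermR ga.
have fx x : x != a -> x != b -> f x = (tperm a b * f)%g x.
  by move=> xa xb; rewrite permM tpermD // eq_sym.
split; last by rewrite fab.
apply/matchingsP; split=> x.
  have [->|xa] := eqVneq x a; first by rewrite fab.
  have [->|xb] := eqVneq x b; first by rewrite fba.
  have fxa : f x != a by rewrite -fba (inj_eq perm_inj).
  have fxb : f x != b by rewrite -fab (inj_eq perm_inj).
  by rewrite fx // fx // ff.
have [->|xa] := eqVneq x a; first by rewrite fab eq_sym ab.
have [->|xb] := eqVneq x b; first by rewrite fba ab.
by rewrite fx // -fA !inE xa xb.
Qed.

(** [P] constrains what is left once the pair is deleted, so that a second pair can be
    prescribed. *)
Lemma card_matching_pair (P : pred {perm D}) A a b :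
    a \in A -> b \in A -> a != b ->
  #|[set f in matchings A | (f a == b) && P (tperm a b * f)%g]|
    = #|[set f in matchings (A :\ a :\ b) | P f]|.
Proof.
move=> aA bA ab; rewrite -[RHS](card_preimset _ (mulgI (tperm a b))).
apply: eq_card => f; rewrite in_set andbA (matching_remove_pair _ aA bA ab).
by rewrite [RHS]in_set [RHS]in_set.
Qed.

Lemma card_setD2 A a b : a \in A -> b \in A -> a != b ->
  #|A| = #|A :\ a :\ b|.+2.
Proof.
by move=> aA bA ab; rewrite (cardsD1 a) aA (cardsD1 b) !inE eq_sym ab bA.
Qed.

(** Classify by the partner of one element [a]: there are [#|A| - 1] choices, each leaving
    [#|A| - 2] points. *)
Lemma card_matchings A : #|matchings A| = dfact #|A|.
Proof.
have [n] := ubnP #|A|; elim: n A => // n IHn A; rewrite ltnS => An.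
have [->|[a aA]] := set_0Vmem A.
  rewrite cards0 /=; apply/eqP/cards1P; exists 1%g; apply/setP=> f.
  rewrite inE; apply/matchingsP/eqP => [[_ f0]|->].
    apply/permP=> x; rewrite perm1; apply/eqP.
    by rewrite -[_ == _]negbK -f0 inE.
  by split=> x; rewrite !perm1 // inE eqxx.
have -> : #|matchings A| = \sum_(b in A :\ a) dfact #|A :\ a :\ b|.
  rewrite -sum1_card (partition_big (fun f : {perm D} => f a) (mem (A :\ a))) /=.
    apply: eq_bigr => b; rewrite inE in_set1 => /andP[ba bA].
    rewrite -IHn; last by rewrite (@card_setD2 A a b) // 1?eq_sym // in An; lia.
    have := @card_matching_pair xpredT A a b aA bA; rewrite eq_sym => /(_ ba).
    rewrite (_ : [set f in matchings (A :\ a :\ b) | true] = matchings (A :\ a :\ b)).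
      by move=> <-; rewrite -sum1_card; apply: eq_bigl => f; rewrite inE andbT.
    by apply/setP=> f; rewrite inE andbT.
  by move=> f /matchingsP[ff fA]; rewrite !inE fA ff [a == _]eq_sym andbb -fA.
rewrite (eq_bigr (fun=> dfact #|A|.-2)); last first.
  move=> b; rewrite inE in_set1 => /andP[ba bA].
  by rewrite (@card_setD2 A a b) // eq_sym.
rewrite sum_nat_const; have := cardsD1 a A; rewrite aA.
by case: #|A :\ a| => [|k] -> //; rewrite mul0n.
Qed.

Lemma card_matchings_pair A a b : a \in A -> b \in A -> a != b ->
  #|[set f in matchings A | f a == b]| = dfact #|A|.-2.
Proof.
move=> aA bA ab; rewrite (card_setD2 aA bA ab) /= -card_matchings.
have := @card_matching_pair xpredT A a b aA bA ab.
rewrite (_ : [set f in matchings (A :\ a :\ b) | true] = matchings (A :\ a :\ b)).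
  by move=> <-; apply: eq_card => f; rewrite !in_set andbT.
by apply/setP=> f; rewrite inE andbT.
Qed.

Lemma card_matchings_2pairs A a b c d : uniq [:: a; b; c; d] ->
    {subset [:: a; b; c; d] <= A} ->
  #|[set f in matchings A | (f a == b) && (f c == d)]| = dfact #|A|.-2.-2.
Proof.
rewrite /= !inE !negb_or => /and4P[/and3P[ab ac ad] /andP[bc bd] cd _] sA.
have [aA bA cA dA] : [/\ a \in A, b \in A, c \in A & d \in A].
  by split; apply: sA; rewrite !inE eqxx ?orbT.
rewrite (card_setD2 aA bA ab) /=.
rewrite -(@card_matchings_pair _ c d) ?inE ?cA ?dA ?andbT //; last first.
  by rewrite eq_sym bd eq_sym ad.
- by rewrite eq_sym bc eq_sym ac.
rewrite -(card_matching_pair (fun f => f c == d) aA bA ab).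
by apply: eq_card => f; rewrite !in_set permM tpermD.
Qed.

(** Such a matching also preserves the rest of [A], and is determined by its restrictions to the two
    parts. *)
Lemma card_stable_matchings A W : W \subset A ->
  #|[set f in matchings A | [forall x in W, f x \in W]]|
    <= dfact #|W| * dfact #|A :\: W|.
Proof.
move=> WA; rewrite -!card_matchings -cardsX.
set S := [set f in _ | _].
have SP f : f \in S -> [/\ forall x, f (f x) = x, forall x, (x \in A) = (f x != x)
  & forall x, (f x \in W) = (x \in W)].
  rewrite inE => /andP[/matchingsP[ff fA] /forall_inP fW]; split=> // x.
  by apply/idP/idP => /fW //; rewrite ff.
pose A' := A :\: W.
have SN f : f \in S -> f \in 'N(W | 'P)%g /\ f \in 'N(A' | 'P)%g.
  move=> /SP[ff fA fW]; split; rewrite !inE /=.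
    by apply/fintype.subsetP=> x; rewrite inE /= /aperm fW.
  by apply/fintype.subsetP=> x; rewrite !inE /= /aperm fW !fA ff eq_sym.
pose h f := (restr_perm W f, restr_perm A' f).
rewrite -(@card_in_imset _ _ h S) => [|f g fS gS [hW hA]]; last first.
  apply/permP=> x; case: (SP f fS) (SP g gS) => [_ fA _] [_ gA _].
  have [[fN fN'] [gN gN']] := (SN f fS, SN g gS).
  have [xW|xW] := boolP (x \in W).
    by have /permP/(_ x) := hW; rewrite !restr_permE.
  have [xA|xA] := boolP (x \in A).
    by have /permP/(_ x) := hA; rewrite !restr_permE // inE xW.
  by move: (fA x) (gA x); rewrite (negPf xA) => /esym/negbFE/eqP-> /esym/negbFE/eqP->.
have restr_m (B : {set D}) f : (forall x, f (f x) = x) -> {subset B <= [pred x | f x != x]} ->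
    f \in 'N(B | 'P)%g -> restr_perm B f \in matchings B.
  move=> ff fB fN; have out x : x \notin B -> restr_perm B f x = x.
    by apply: out_perm; apply: restr_perm_on.
  apply/matchingsP; split=> x; have [xB|xB] := boolP (x \in B).
  - have fxB : f x \in B by have := astabs_act x fN; rewrite /= /aperm xB => ->.
    by rewrite !restr_permE.
  - by rewrite !out.
  - by rewrite restr_permE //; apply/esym/fB.
  - by rewrite out // eqxx.
apply/subset_leq_card/fintype.subsetP => _ /imsetP[f fS ->].
have [[ff fA fW] [fN fN']] := (SP f fS, SN f fS).
rewrite inE /=; apply/andP; split; apply: restr_m => // x.
  by move=> /(fintype.subsetP WA); rewrite fA inE.
by rewrite !inE => /andP[_]; rewrite fA.
Qed.

End Matchings.

(** Induction by Pascal's rule: the two terms carry the factors 2b + 1 and 2a + 1, whose sum is one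
    less than the new factor 2(a + b) + 3 on the right. *)
Lemma dfact_bin a b : dfact a.*2 * dfact b.*2 * 'C(a + b, a) <= dfact (a + b).*2.
Proof.
have [n] := ubnP (a + b); elim: n a b => // n IHn [|a] [|b]; rewrite ltnS => abn.
- by [].
- by rewrite add0n bin0 mul1n muln1.
- by rewrite addn0 binn !muln1.
have H1 := IHn a b.+1 ltac:(lia); have H2 := IHn a.+1 b ltac:(lia).
have dE m : dfact m.+1.*2 = m.*2.+1 * dfact m.*2 by [].
rewrite addnS in H1; rewrite addSn in H2; rewrite addSn addnS.
rewrite binS mulnDr [dfact (a + b).+2.*2]dE.
have -> : (a + b).+1.*2.+1 = b.*2.+1 + a.*2.+1 + 1 by lia.
rewrite [(_ + 1) * _]mulnDl; apply: leq_trans (leq_addr _ _).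
have := dE a; have := dE b; move: H1 H2.
move: (dfact a.+1.*2) (dfact b.+1.*2) (dfact a.*2) (dfact b.*2) => A1 B1 A B.
move=> H1 H2 EB EA; rewrite mulnDl leq_add //.
  by rewrite EB mulnCA -!mulnA leq_mul2l mulnA H2 orbT.
by rewrite EA -!mulnA leq_mul2l mulnA H1 orbT.
Qed.

(** * Proportion of simple pairings *)

Lemma leq_card_union (I T : finType) (A : {set T}) (P : pred I) (F : I -> {set T}) :
  (forall x, x \in A -> exists2 i, P i & x \in F i) ->
  #|A| <= \sum_(i | P i) #|F i|.
Proof.
move=> AF; apply: (@leq_trans #|\bigcup_(i | P i) F i|).
  by apply/subset_leq_card/fintype.subsetP=> x /AF[i Pi xi]; apply/bigcupP; exists i.
elim/big_rec2: _ => [|i m B _ Bm]; first by rewrite cards0.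
by apply: leq_trans (leq_card_setU _ _) _; rewrite leq_add2l.
Qed.

Section Configurations.
Variables (V : finType) (r : nat).
Local Notation D := (V * 'I_r)%type.
Implicit Types (f : {perm D}) (a b c d x y : D) (u v w : V) (oi : option 'I_r).

(* The point (u, i) is the i-th half-edge at the vertex u. *)
Definition pairings : {set {perm D}} := matchings [set: D].

Lemma pairingsP f :
  reflect ((forall x, f (f x) = x) /\ (forall x, f x != x)) (f \in pairings).
Proof.
apply: (iffP (matchingsP f _)) => [] [ff fD]; split=> // x.
  by rewrite -fD inE.
by rewrite fD inE.
Qed.

(** Either [a] lies in a loop, or a second half-edge [c] at its vertex leads to the same vertex,
    giving a multiple edge. *)
Definition defective f a : bool :=
  ((f a).1 == a.1) ||
  [exists c, [&& c != a, c.1 == a.1 & (f c).1 == (f a).1]].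

Definition defects f : {set D} := [set a | defective f a].

Definition pairings_upto k := [set f in pairings | #|defects f| <= k].

(** A loop prescribes one pair, with [r] choices. A multiple edge prescribes two: choose the index
    of [c], the partner of [a] and the index of the partner of [c]. *)
Lemma card_defective a : 
  #|[set f in pairings | defective f a]|
    <= r * dfact (#|{:D}| - 2) + r * (#|{:D}| * r) * dfact (#|{:D}| - 4).
Proof.
pose Floop (i : 'I_r) := [set f in pairings | f a == (a.1, i)].
pose Fpar (t : 'I_r * (D * 'I_r)) :=
  [set f in pairings | (f a == t.2.1) && (f (a.1, t.1) == (t.2.1.1, t.2.2))].
pose Ppar (t : 'I_r * (D * 'I_r)) :=
  uniq [:: a; t.2.1; (a.1, t.1); (t.2.1.1, t.2.2)].
apply: (@leq_trans (\sum_(i | (a.1, i) != a) #|Floop i| + \sum_(t | Ppar t) #|Fpar t|)).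
  pose P s := match s with inl i => (a.1, i) != a | inr t => Ppar t end.
  pose F s := match s with inl i => Floop i | inr t => Fpar t end.
  have := @leq_card_union _ _ _ P F; rewrite big_sumType /=; apply => f; rewrite inE => /andP[fM].
  have [ff fN] := pairingsP f fM.
  rewrite /defective; case: eqP => [fa _|/eqP fa /existsP[c /and3P[ca c1 fc]]].
    have fE : (a.1, (f a).2) = f a by rewrite -fa -surjective_pairing.
    by exists (inl (f a).2) => /=; [rewrite fE fN | apply/setIdP; rewrite fE].
  have cE : (a.1, c.2) = c by rewrite -(eqP c1) -surjective_pairing.
  have fE : ((f a).1, (f c).2) = f c by rewrite -(eqP fc) -surjective_pairing.
  exists (inr (c.2, (f a, (f c).2))) => /=; last first.
    by apply/setIdP; rewrite /= cE fE !eqxx.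
  rewrite /Ppar /= cE fE !inE.
  rewrite !negb_or [f a == f c]eq_sym (inj_eq perm_inj) [a == c]eq_sym.
  rewrite [c == f c]eq_sym [a == f a]eq_sym !fN ca /= !andbT.
  have fca : f a != c by apply: contraNneq fa => ->.
  by rewrite fca andbT -(inj_eq (@perm_inj _ f)) ff.
have cD : #|[set: D]| = #|{:D}| by rewrite cardsT.
apply: leq_add.
  apply: (@leq_trans (\sum_(i | (a.1, i) != a) dfact (#|{:D}| - 2))).
    apply: leq_sum => i ia.
    by rewrite card_matchings_pair ?inE // 1?eq_sym // cD subn2.
  by rewrite sum_nat_const leq_mul2r -[X in _ <= X]card_ord max_card orbT.
apply: (@leq_trans (\sum_(t | Ppar t) dfact (#|{:D}| - 4))).
  apply: leq_sum => t Pt.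
  rewrite (card_matchings_2pairs Pt) ?cD; last by move=> z _; rewrite inE.
  by rewrite -!subn2 -subnDA.
rewrite sum_nat_const leq_mul2r; apply/orP; right.
by rewrite -[X in X * (_ * X)]card_ord -!card_prod max_card.
Qed.

Lemma dfact_rec n : dfact n.+2 = n.+1 * dfact n.
Proof. by []. Qed.

Lemma sum_card_defects : 6 <= #|{:D}| ->
  \sum_(f in pairings) #|defects f| <= (2 * r + 4 * r ^ 2) * #|pairings|.
Proof.
move=> D6.
have -> : \sum_(f in pairings) #|defects f|
        = \sum_a #|[set f in pairings | defective f a]|.
  transitivity (\sum_(f in pairings) \sum_a (defective f a : nat)).
    apply: eq_bigr => f _; rewrite -sum1_card big_mkcond.
    by apply: eq_bigr => a _; rewrite inE; case: (defective f a).
  rewrite exchange_big; apply: eq_bigr => a _ /=; rewrite -sum1_card.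
  rewrite [RHS](eq_bigl (fun f => (f \in pairings) && defective f a)) => [|f].
    by rewrite [RHS]big_mkcondr; apply: eq_bigr => f _; case: (defective f a).
  by rewrite in_set.
apply: (@leq_trans (\sum_(a : D) (r * dfact (#|{:D}| - 2)
    + r * (#|{:D}| * r) * dfact (#|{:D}| - 4)))).
  by apply: leq_sum => a _; exact: card_defective.
rewrite card_matchings cardsT.
have sumD k : \sum_(a : D) k = #|{:D}| * k by rewrite sum_nat_const.
rewrite sumD; move: D6; case: #|{:D}| => [|[|[|[|n]]]] // n4.
have -> : n.+4 - 2 = n.+2 by lia.
have -> : n.+4 - 4 = n by lia.
rewrite dfact_rec [dfact n.+4]dfact_rec dfact_rec -mulnn.
move: (dfact n) => X.
(* Termwise: n + 4 <= 2(n + 3) and (n + 4)^2 <= 4(n + 3)(n + 1), where n + 4 is the number of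
   half-edges. *)
have : n.+4 * (r * n.+1 + r * (n.+4 * r)) * X
    <= (2 * r + 4 * (r * r)) * (n.+3 * n.+1) * X.
  by rewrite leq_mul2r; apply/orP; right; nia.
nia.
Qed.

Lemma card_few_defects : 6 <= #|{:D}| -> 0 < r ->
  #|pairings| <= 2 * #|pairings_upto (4 * r + 8 * r ^ 2)|.
Proof.
move=> D6 r0; have := sum_card_defects D6.
(* [h] bounds the mean number of defects; Markov's inequality is applied at [2 * h]. *)
set h := 2 * r + 4 * r ^ 2; have -> : 4 * r + 8 * r ^ 2 = 2 * h by lia.
pose big := [set f in pairings | 2 * h < #|defects f|].
have -> : #|pairings| = #|pairings_upto (2 * h)| + #|big|.
  rewrite -!sum1_card (bigID (fun f => #|defects f| <= 2 * h)) /=.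
  by congr (_ + _); apply: eq_bigl => f; rewrite !inE // ltnNge.
have : #|big| * (2 * h) <= \sum_(f in pairings) #|defects f|.
  rewrite (bigID (fun f => 2 * h < #|defects f|)) /=.
  apply: leq_trans (leq_addr _ _); rewrite -sum_nat_const.
  rewrite [X in X <= _](eq_bigl (fun f => (f \in pairings) && (2 * h < #|defects f|))).
    by apply: leq_sum => f /andP[_ /ltnW].
  by move=> f; rewrite in_set.
have : 0 < h by rewrite /h; lia.
nia.
Qed.

(** [None] codes [u] itself, so the closed neighbourhood of [u] is listed by [r.+1] codes. *)
Definition neighbour f u oi : V := if oi is Some i then (f (u, i)).1 else u.
Definition near f u w : bool := [exists oi, neighbour f u oi == w].

Lemma near_refl f u : near f u u.
Proof. by apply/existsP; exists None; rewrite /= eqxx. Qed.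

Lemma near_edge f c : near f c.1 (f c).1.
Proof. by apply/existsP; exists (Some c.2); rewrite /= -surjective_pairing. Qed.

Lemma near_edgeC f c : f \in pairings -> near f (f c).1 c.1.
Proof. by move=> /pairingsP[ff _]; rewrite -{2}(ff c) near_edge. Qed.

Lemma card_near f u : #|[set x : D | near f u x.1]| <= r.+1 * r.
Proof.
have -> : r.+1 * r = #|{: option 'I_r * 'I_r}| by rewrite card_prod card_option card_ord.
rewrite -cardsT.
apply: leq_trans (leq_imset_card (fun t => (neighbour f u t.1, t.2)) _).
apply/subset_leq_card/fintype.subsetP=> x; rewrite inE => /existsP[oi /eqP oix].
by apply/imsetP; exists (oi, x.2); rewrite ?inE //= oix -surjective_pairing.
Qed.

Lemma card_near_perm f u : #|[set x : D | near f u (f x).1]| <= r.+1 * r.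
Proof.
rewrite -[X in X <= _](_ : #|f @^-1: [set x : D | near f u x.1]| = _); last first.
  by apply: eq_card => x; rewrite !inE.
by rewrite card_preimset ?card_near //; exact: perm_inj.
Qed.

(** Ensures that switching the pairs of [a] and [x] creates no loop or multiple edge. *)
Definition remote f a x : bool :=
  [&& x \notin defects f, ~~ near f a.1 x.1, ~~ near f (f a).1 x.1,
      ~~ near f a.1 (f x).1 & ~~ near f (f a).1 (f x).1].

Lemma card_remote f a :
  #|{:D}| <= #|[set x | remote f a x]| + (#|defects f| + 4 * (r.+1 * r)).
Proof.
rewrite -cardsT.
apply: (@leq_trans #|[set x | remote f a x] :|: (defects f :|:
  (([set x : D | near f a.1 x.1] :|: [set x : D | near f (f a).1 x.1]) :|:
   ([set x : D | near f a.1 (f x).1] :|: [set x : D | near f (f a).1 (f x).1])))|).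
  apply/subset_leq_card/fintype.subsetP=> x _; rewrite !inE /remote !inE.
  by case: (defective _ _); case: (near _ _ _); case: (near _ _ _);
     case: (near _ _ _); case: (near _ _ _).
do 2![apply: leq_trans (leq_card_setU _ _) _; rewrite leq_add2l].
rewrite (_ : 4 * _ = (r.+1 * r + r.+1 * r) + (r.+1 * r + r.+1 * r)); last by lia.
do 2![apply: leq_trans (leq_card_setU _ _) _; apply: leq_add];
  rewrite ?card_near ?card_near_perm //.
Qed.

(** * Switching two pairs of a pairing *)

Lemma switchE f (t : {perm D}) x : (forall y, t (t y) = y) ->
  (f ^ t)%g x = t (f (t x)).
Proof. by move=> tt; rewrite -{1}(tt x) permJ. Qed.

Lemma switch_pairings f b x : f \in pairings -> (f ^ tperm b x)%g \in pairings.
Proof.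
move=> /pairingsP[ff fN]; apply/pairingsP; split=> y;
  rewrite !(switchE _ _ (@tpermK _ b x)) ?tpermK ?ff ?tpermK //.
by rewrite (can2_eq (tpermK b x) (tpermK b x)) fN.
Qed.

Lemma defective_sym f a : f \in pairings -> defective f a -> defective f (f a).
Proof.
move=> /pairingsP[ff _] /orP[/eqP fa|/existsP[c /and3P[ca c1 fc]]].
  by rewrite /defective ff fa eqxx.
apply/orP; right; apply/existsP; exists (f c).
by rewrite !ff (inj_eq perm_inj) ca c1 fc.
Qed.

(* Conjugating f by [tperm b x] turns the pairs {a, b} and {x, y} into {a, x}
   and {b, y}. *)
Section Switch.
Variables (f : {perm D}) (a x : D).
Hypotheses (fM : f \in pairings) (ax : remote f a x).
Let b := f a.
Let y := f x.
Let f' := (f ^ tperm b x)%g.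

Let ff z : f (f z) = z. Proof. by have [H _] := pairingsP f fM. Qed.
Let fN z : f z != z. Proof. by have [_ H] := pairingsP f fM. Qed.

Let xa : x.1 <> a.1.
Proof. by move=> e; case/and5P: ax => _; rewrite e near_refl. Qed.
Let xb : x.1 <> b.1.
Proof. by move=> e; case/and5P: ax => _ _; rewrite e near_refl. Qed.
Let ya : y.1 <> a.1.
Proof. by move=> e; case/and5P: ax => _ _ _; rewrite e near_refl. Qed.
Let yb : y.1 <> b.1.
Proof. by move=> e; case/and5P: ax => _ _ _ _; rewrite e near_refl. Qed.
Let xy : x.1 <> y.1.
Proof.
by move=> e; case/and5P: ax => + _ _ _ _; rewrite inE /defective -/y e eqxx.
Qed.

Lemma switch_a : f' a = x.
Proof.
rewrite /f' switchE; last exact: tpermK.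
rewrite (@tpermD _ b x a) ?tpermL //; first exact: fN.
by apply/eqP=> e; apply: xa; rewrite e.
Qed.

Lemma switch_b : f' b = y.
Proof.
rewrite /f' switchE; last exact: tpermK.
rewrite tpermL tpermD //; apply/eqP=> e; first by apply: yb; rewrite /y -e.
by apply: xy; rewrite /y -e.
Qed.

Lemma switch_other z : z != a -> z != b -> z != x -> z != y -> f' z = f z.
Proof.
move=> za zb zx zy; rewrite /f' switchE; last exact: tpermK.
rewrite (@tpermD _ b x z) 1?eq_sym // tpermD // eq_sym.
  by rewrite (inj_eq perm_inj).
by apply: contraNneq zy => e; rewrite /y -e ff.
Qed.

Let f'M : f' \in pairings. Proof. exact: switch_pairings. Qed.
Let f'f' z : f' (f' z) = z. Proof. by have [H _] := pairingsP f' f'M. Qed.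
Let switch_x : f' x = a. Proof. by rewrite -switch_a f'f'. Qed.
Let switch_y : f' y = b. Proof. by rewrite -switch_b f'f'. Qed.

Let far_ax : near f a.1 x.1 = false.
Proof. by case/and5P: ax => _ /negPf. Qed.
Let far_by : near f b.1 y.1 = false.
Proof. by case/and5P: ax => _ _ _ _ /negPf. Qed.

Variant switch_spec z : D -> Prop :=
  | Switch_a of z = a : switch_spec z x
  | Switch_b of z = b : switch_spec z y
  | Switch_x of z = x : switch_spec z a
  | Switch_y of z = y : switch_spec z b
  | Switch_other of z != a & z != b & z != x & z != y : switch_spec z (f z).

Lemma switchP z : switch_spec z (f' z).
Proof.
have [->|za] := eqVneq z a; first by rewrite switch_a; apply: Switch_a.
have [->|zb] := eqVneq z b; first by rewrite switch_b; apply: Switch_b.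
have [->|zx] := eqVneq z x; first by rewrite switch_x; apply: Switch_x.
have [->|zy] := eqVneq z y; first by rewrite switch_y; apply: Switch_y.
by rewrite switch_other //; apply: Switch_other.
Qed.

Lemma switch_ok_a : ~~ defective f' a.
Proof.
rewrite /defective switch_a negb_or; apply/andP; split; first exact/eqP.
apply/existsP=> -[c /and3P[/eqP ca /eqP c1 /eqP]].
case: (switchP c) => [|_ e|cx|cy|_ _ _ _ e] //.
- exact/xy.
- by case: xa; rewrite -c1 cx.
- by case: ya; rewrite -c1 cy.
- by move: far_ax; rewrite -c1 -e near_edge.
Qed.

Lemma switch_ok_b : ~~ defective f' b.
Proof.
rewrite /defective switch_b negb_or; apply/andP; split; first exact/eqP.
apply/existsP=> -[c /and3P[/eqP cb /eqP c1 /eqP]].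
case: (switchP c) => [_ e||cx|cy|_ _ _ _ e] //.
- by case: xb; rewrite -c1 cx.
- by case: yb; rewrite -c1 cy.
- by move: far_by; rewrite -c1 -e near_edge.
Qed.

(** The four switched half-edges are not defective. Any other [c] defective in [f'] has its parallel
    half-edge among the unswitched ones, since a switched one would contradict remoteness; so [c]
    was defective already. *)
Lemma switch_defects : defects f' \subset defects f :\ a.
Proof.
apply/fintype.subsetP=> c; rewrite !inE => dc.
have okC z : ~~ defective f' (f' z) -> ~~ defective f' z.
  by apply: contra; apply: defective_sym.
have ca : c != a by apply: contraTneq dc => ->; exact: switch_ok_a.
have cb : c != b by apply: contraTneq dc => ->; exact: switch_ok_b.
have cx : c != x.
  by apply: contraTneq dc => ->; apply: okC; rewrite switch_x switch_ok_a.
have cy : c != y.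
  by apply: contraTneq dc => ->; apply: okC; rewrite switch_y switch_ok_b.
rewrite ca; move: dc; rewrite /defective switch_other //.
case/orP=> [->//|/existsP[c' /and3P[c'c /eqP c1 /eqP]]].
case: (switchP c') => [ez|ez|ez|ez|_ _ _ _] e.
- by move: far_ax; rewrite e -ez c1 near_edge.
- by move: far_by; rewrite e -ez c1 near_edge.
- by move: far_ax; rewrite e -ez c1 near_edgeC.
- by move: far_by; rewrite e -ez c1 near_edgeC.
by apply/orP; right; apply/existsP; exists c'; rewrite c'c c1 e !eqxx.
Qed.

(** If [a] was in a loop, [b] is at its vertex; otherwise the parallel edge survives the switching.
    Hence few codes suffice to recover [b]. *)
Lemma switch_near : a \in defects f -> near f' a.1 b.1.
Proof.
rewrite inE => /orP[/eqP->|/existsP[c /and3P[ca /eqP c1 /eqP fc]]].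
  exact: near_refl.
have [cb|cb] := eqVneq c b; first by rewrite -cb c1 near_refl.
have <- : (f' c).1 = b.1.
  rewrite switch_other //; first by apply/eqP=> e; apply: xa; rewrite -e.
  by apply/eqP=> e; apply: ya; rewrite -e.
by rewrite -c1 near_edge.
Qed.

End Switch.

(* Double counting of the switchings that remove a defect: at least half of the
   points x can be used from a given pairing with k.+1 defects, and a switching
   is recovered from its result and from a, b, where the vertex of b is a.1 or
   adjacent to a.1. *)
Lemma card_switch k :
    #|{:D}| <= 2 * (#|{:D}| - (k.+1 + 4 * (r.+1 * r))) -> 0 < #|{:D}| ->
  #|[set f in pairings | #|defects f| == k.+1]|
    <= 2 * (r.+1 * r) * #|pairings_upto k|.
Proof.
move=> Dk D0; set C1 := [set f in pairings | _]; set C0 := pairings_upto k.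
pose X := [set t : {perm D} * D | (t.1 \in C1) &&
  [exists a in defects t.1, remote t.1 a t.2]].
pose Z := setX C0 [set: D * (option 'I_r * 'I_r)].
(* Undoes the switching: [b] is read off the code [(oi, j)], [x] is the new partner of [a], and the
   same transposition conjugates back. *)
pose psi (z : {perm D} * (D * (option 'I_r * 'I_r))) :=
  let: (f, (a, (oi, j))) := z in
  ((f ^ tperm (neighbour f a.1 oi, j) (f a))%g, f a).
have XZ : X \subset psi @: Z.
  apply/fintype.subsetP=> -[f x] /setIdP[/= /setIdP[fM /eqP fk]].
  case/exists_inP=> a da ax; set b := f a.
  have /existsP[oi /eqP oib] := switch_near fM ax da.
  apply/imsetP; exists ((f ^ tperm b x)%g, (a, (oi, b.2))).
    apply/setXP; split; last by rewrite inE.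
    apply/setIdP; split; first exact: switch_pairings.
    apply: leq_trans (subset_leq_card (switch_defects fM ax)) _.
    by move: fk; rewrite (cardsD1 a) da add1n => -[->].
  rewrite /psi oib (switch_a fM ax) -surjective_pairing.
  by rewrite -conjgM -{2}(tpermV b x) mulgV conjg1.
have := leq_trans (subset_leq_card XZ) (leq_imset_card _ _).
rewrite cardsX cardsT !card_prod card_option !card_ord.
have : #|C1| * (#|{:D}| - (k.+1 + 4 * (r.+1 * r))) <= #|X|.
  rewrite -[#|X|]sum1_card.
  rewrite (eq_bigl (fun t : {perm D} * D => (t.1 \in C1) &&
    [exists a in defects t.1, remote t.1 a t.2])); last by move=> t; rewrite inE.
  rewrite -(pair_big_dep (mem C1)
    (fun f x => [exists a in defects f, remote f a x]) (fun _ _ => 1)) /=.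
  rewrite -sum_nat_const; apply: leq_sum => f /setIdP[fM /eqP fk].
  have [a da] : exists a, a \in defects f.
    by apply/set0Pn; rewrite -cards_eq0 fk.
  rewrite leq_subLR -fk addnC; apply: leq_trans (card_remote f a) _.
  rewrite leq_add2r sum1dep_card; apply/subset_leq_card/fintype.subsetP=> x.
  by rewrite !inE => ax; apply/exists_inP; exists a.
rewrite card_prod card_ord in Dk D0 *.
move: Dk D0; move: (#|V| * r) => N; move: (N - _) => m Nm N0 mX XN.
rewrite -(leq_pmul2r N0); apply: (@leq_trans (2 * #|X|)).
  apply: leq_trans (leq_mul (leqnn _) Nm) _.
  by rewrite mulnCA leq_mul2l mX orbT.
by move: #|X| #|C0| XN => p q; nia.
Qed.

Definition simple_pairings := pairings_upto 0.

(** By [card_switch], each further defect allowed multiplies the count by at most 1 + 2(r + 1)r. *)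
Lemma card_pairings_upto K k : k <= K ->
    #|{:D}| <= 2 * (#|{:D}| - (K + 4 * (r.+1 * r))) -> 0 < #|{:D}| ->
  #|pairings_upto k| <= (2 * (r.+1 * r)).+1 ^ k * #|simple_pairings|.
Proof.
move=> + DK D0; elim: k => [|k IHk] kK; first by rewrite expn0 mul1n.
have {}IHk := IHk (ltnW kK).
have -> : #|pairings_upto k.+1| = #|pairings_upto k|
    + #|[set f in pairings | #|defects f| == k.+1]|.
  rewrite -!sum1_card (bigID (fun f => #|defects f| <= k)) /=.
  by congr (_ + _); apply: eq_bigl => f; rewrite !in_set; case: (f \in pairings) => //=; lia.
have := @card_switch k; rewrite expnS.
move=> /(_ _ D0)-/(_ ltac:(lia)).
move: IHk; set A := #|pairings_upto k|; set B := #|simple_pairings|; set e := _ ^ k.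
nia.
Qed.

Lemma card_pairings_simple : 0 < r -> 6 <= #|{:D}| ->
    #|{:D}| <= 2 * (#|{:D}| - (4 * r + 8 * r ^ 2 + 4 * (r.+1 * r))) ->
  #|pairings| <=
    2 * (2 * (r.+1 * r)).+1 ^ (4 * r + 8 * r ^ 2) * #|simple_pairings|.
Proof.
move=> r0 D6 DK; apply: leq_trans (card_few_defects D6 r0) _.
rewrite -mulnA leq_mul2l /=; apply: card_pairings_upto (leqnn _) DK _.
exact: leq_trans D6.
Qed.

End Configurations.

(** * Graphs of pairings *)

Lemma eq_set2 (T : finType) (a b c d : T) : [set a; b] = [set c; d] ->
  (a = c /\ b = d) \/ (a = d /\ b = c).
Proof.
move=> e; have := set21 a b; have := set22 a b.
have := set21 c d; have := set22 c d; rewrite e -{1 2}e !in_set2.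
by do 4![case/orP => /eqP ?]; (left; split; congruence) || (right; split; congruence).
Qed.

Section GraphOfPairing.
Variables (V : finType) (r : nat).
Local Notation D := (V * 'I_r)%type.
Implicit Types (f g : {perm D}) (u w : V) (E : {set {set V}}).
Local Notation pairings := (pairings V r).
Local Notation simple_pairings := (simple_pairings V r).

Definition edges_of f : {set {set V}} := [set [set x.1; (f x).1] | x : D].

Lemma adj_edges_of f u w : f \in pairings ->
  adj (edges_of f) u w = [exists i, (f (u, i)).1 == w].
Proof.
case/pairingsP=> ff _; apply/imsetP/existsP => [[[v i] _ /eq_set2]|[i /eqP<-]].
  case=> /= -[-> ->]; first by exists i.
  by exists (f (v, i)).2; rewrite -surjective_pairing ff.
by exists (u, i).
Qed.

Lemma simple_pairingsP f : f \in simple_pairings ->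
  [/\ f \in pairings, forall x, (f x).1 != x.1
    & forall u, injective (fun i => (f (u, i)).1)].
Proof.
case/setIdP=> fM; rewrite leqn0 cards_eq0 => /eqP/setP d0.
have {}d0 x : defective f x = false by have := d0 x; rewrite !inE.
split=> // [x|u i j fij]; first by have /norP[] := negbT (d0 x).
apply/eqP; apply: contraFT (d0 (u, j)) => ij; apply/orP; right.
by apply/existsP; exists (u, i); rewrite fij !eqxx xpair_eqE eqxx ij.
Qed.

Lemma edges_of_regular f : f \in simple_pairings ->
  simple_graph (edges_of f) && regular r (edges_of f).
Proof.
case/simple_pairingsP=> fM fN finj; apply/andP; split.
  by apply/forall_inP=> _ /imsetP[x _ ->]; rewrite cards2 [x.1 == _]eq_sym fN.
apply/forallP=> u; rewrite (_ : [set w | _] = [set (f (u, i)).1 | i : 'I_r]).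
  by rewrite card_imset ?card_ord.
apply/setP=> w; rewrite inE adj_edges_of //.
apply/existsP/imsetP => [[i /eqP<-]|[i _ ->]]; last by exists i.
by exists i.
Qed.

Definition neighbour_lists f : {ffun V -> {ffun 'I_r -> V}} :=
  [ffun u => [ffun i => (f (u, i)).1]].

(* A simple pairing is the same as its graph together with a numbering by 'I_r
   of the neighbours of each vertex. *)
Definition numberings E u : {set {ffun 'I_r -> V}} :=
  [set g in ffun_on (mem [set w | adj E u w]) | injectiveb g].

Lemma card_numberings E : regular r E ->
  #|family (numberings E)| = r`! ^ #|V|.
Proof.
move=> /forallP rE; rewrite card_family (cardE V) /image_mem.
elim: (enum V) => //= u s ->.
by rewrite expnS card_inj_ffuns_on (eqP (rE u)) card_ord ffactnn.
Qed.

(** Pair [(u, i)] with [(w, j)], where [w] is the [i]-th neighbour of [u] and [u] is the [j]-th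
    neighbour of [w]. *)
Lemma pairing_of_lists E F : simple_graph E -> regular r E ->
    F \in family (numberings E) ->
  exists2 f, f \in simple_pairings & neighbour_lists f = F /\ edges_of f = E.
Proof.
move=> /forall_inP sE rE /familyP FE.
have FP u : (forall i, adj E u (F u i)) /\ injective (F u).
  have := FE u; rewrite inE => /andP[/ffun_onP Fu /injectiveP Finj].
  by split=> // i; have := Fu i; rewrite inE.
(* [F u] is injective into a set of [r] neighbours, hence onto. *)
have imF u w : adj E u w -> exists i, F u i = w.
  have -> : adj E u w = (w \in [set F u i | i : 'I_r]).
    have <- : [set w | adj E u w] = [set F u i | i : 'I_r].
      apply/esym/eqP; rewrite eqEcard card_imset; last by have [] := FP u.
      rewrite card_ord (eqP (forallP rE u)) leqnn andbT.
      by apply/fintype.subsetP=> _ /imsetP[i _ ->]; rewrite inE; have [] := FP u.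
    by rewrite inE.
  by case/imsetP=> i _ ->; exists i.
have adjE u w : adj E u w = adj E w u by rewrite /adj setUC.
(* The default [x.2] is never reached, because adjacency is symmetric and [F] lists all
   neighbours. *)
pose f0 (x : D) : D :=
  (F x.1 x.2, odflt x.2 [pick j | F (F x.1 x.2) j == x.1]).
have f0E x : F (F x.1 x.2) (f0 x).2 = x.1.
  rewrite /f0 /=; case: pickP => [j /eqP //|no].
  have [|j ej] := imF (F x.1 x.2) x.1; first by rewrite adjE; have [] := FP x.1.
  by move: (no j); rewrite ej eqxx.
have f0f0 x : f0 (f0 x) = x.
  have e1 : (f0 (f0 x)).1 = x.1 by rewrite {1}/f0 /= f0E.
  rewrite [LHS]surjective_pairing [RHS]surjective_pairing e1; congr (_, _).
  have [_ Finj] := FP x.1; apply: Finj.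
  have e2 : F (f0 x).1 (f0 x).2 = x.1 := f0E x.
  by have := f0E (f0 x); rewrite e2.
have f0N x : (f0 x).1 != x.1.
  apply: contraTneq isT => e; have [Fa _] := FP x.1; have := sE _ (Fa x.2).
  by rewrite -[F _ _]/((f0 x).1) e cards2 eqxx.
pose f := perm (can_inj f0f0).
have fM : f \in pairings.
  apply/pairingsP; split=> x; rewrite !permE ?f0f0 //.
  by apply: contraNneq (f0N x) => ->.
have ff x : f x = f0 x by rewrite permE.
exists f.
  apply/setIdP; split=> //; rewrite leqn0 cards_eq0; apply/eqP/setP=> x.
  rewrite !inE /defective !ff (negPf (f0N x)) /=; apply/existsP=> -[c].
  case/and3P=> cx /eqP c1 /eqP; rewrite !ff /f0 /= c1 => e.
  case/eqP: cx; rewrite [LHS]surjective_pairing [RHS]surjective_pairing c1.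
  by congr (_, _); have [_] := FP x.1; apply.
split; first by apply/ffunP=> u; rewrite ffunE; apply/ffunP=> i; rewrite ffunE ff.
apply/setP=> e; apply/imsetP/idP => [[x _ ->]|eE].
  by rewrite ff; have [Fa _] := FP x.1; apply: Fa.
have [u [w [uw ee]]] := cards2P _ (sE e eE); rewrite ee in eE *.
have [i <-] := imF u w eE.
by exists (u, i); rewrite ?ff.
Qed.

Lemma card_pairings_of_graph E : simple_graph E -> regular r E ->
  #|[set f in simple_pairings | edges_of f == E]| = r`! ^ #|V|.
Proof.
move=> sE rE; rewrite -(card_numberings rE).
set S := [set f in _ | _].
have SP f : f \in S -> f \in simple_pairings /\ edges_of f = E.
  by case/setIdP=> fM /eqP.
have inj f u i j : f \in S -> (f (u, i)).1 = (f (u, j)).1 -> i = j.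
  by case/SP=> /simple_pairingsP[_ _ finj] _; apply: finj.
rewrite -(@card_in_imset _ _ neighbour_lists) => [|f g fS gS /ffunP fg].
  apply: eq_card => F; apply/imsetP/idP => [[f fS ->]|].
    have [fM fE] := SP f fS; have [fP _ _] := simple_pairingsP fM.
    apply/familyP=> u; rewrite inE; apply/andP; split.
      apply/ffun_onP=> i; rewrite !ffunE inE -fE adj_edges_of //.
      by apply/existsP; exists i.
    apply/injectiveP=> i j; rewrite !ffunE; exact: inj.
  move=> FE; have [f fM [fF fE]] := pairing_of_lists sE rE FE.
  by exists f => //; apply/setIdP; rewrite fE.
have {}fg x : (f x).1 = (g x).1.
  by have := fg x.1; rewrite !ffunE => /ffunP/(_ x.2); rewrite !ffunE -surjective_pairing.
have [[fM _] [gM _]] := (SP f fS, SP g gS).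
have [/pairingsP[ff _] _ _] := simple_pairingsP fM.
have [/pairingsP[gg _] _ _] := simple_pairingsP gM.
(* [f x] and [g x] are half-edges at one vertex, and [f] leads both to [x.1]; as [f] is simple, they
   coincide. *)
apply/permP=> x; rewrite [LHS]surjective_pairing [RHS]surjective_pairing fg.
congr (_, _); apply: (inj f (g x).1) => //.
by rewrite -{1}fg -surjective_pairing ff fg -surjective_pairing gg.
Qed.

Lemma card_graphs_pairings (G : {set {set {set V}}}) :
    (forall E, E \in G -> simple_graph E && regular r E) ->
  #|G| * r`! ^ #|V| = #|[set f in simple_pairings | edges_of f \in G]|.
Proof.
move=> GP; rewrite -sum_nat_const -[RHS]sum1_card.
rewrite (partition_big edges_of (mem G)) /= => [|f]; last by case/setIdP.
apply: eq_bigr => E EG; have /andP[sE rE] := GP E EG.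
rewrite -(card_pairings_of_graph sE rE) -sum1_card.
apply: eq_bigl => f; apply/setIdP/andP => [[fM fE]|[/setIdP[fM _] fE]] //.
by split=> //; apply/setIdP; rewrite (eqP fE).
Qed.

End GraphOfPairing.

(** * Pairings with a small separation *)

Lemma dfact_odd n : odd n -> dfact n = 0.
Proof.
have [m] := ubnP n; elim: m n => // m IHm [|[|n]] //; rewrite ltnS => nm.
by rewrite dfact_rec /= negbK => on; rewrite IHm ?muln0 //; lia.
Qed.

Lemma dfact_even_gt0 n : ~~ odd n -> 0 < dfact n.
Proof.
have [m] := ubnP n; elim: m n => // m IHm [|[|n]] //; rewrite ltnS => nm.
by rewrite dfact_rec /= negbK => on; rewrite muln_gt0 IHm //; lia.
Qed.

Lemma leq_exp_ffact q k : q ^ k <= (q + k) ^_ k.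
Proof.
elim: k => // k IHk; rewrite expnS addnS ffactSS leq_mul //.
by rewrite -addnS leq_addr.
Qed.

(** One term of Vandermonde's identity. *)
Lemma leq_bin_mul n M s h : 'C(n, s) * 'C(M, h) <= 'C(n + M, s + h).
Proof.
have sh : s < (s + h).+1 by rewrite ltnS leq_addr.
by rewrite -binomial.Vandermonde (bigD1 (Ordinal sh)) //= addKn leq_addr.
Qed.

Lemma leq_exp_bin q h k : k <= h -> q ^ k <= 'C(q + h, h) * k`!.
Proof.
move=> kh; apply: leq_trans (leq_exp_ffact q k) _; rewrite -bin_ffact.
rewrite leq_mul2r -(@bin_sub (q + k) k) ?leq_addl // addnK.
by rewrite -(@bin_sub (q + h) h) ?leq_addl // addnK leq_bin2l ?orbT // leq_add2l.
Qed.

(* With 2 m = n r and 2 a = s r + d, the proportion dfact (2 a) * dfact (2 m - 2 a)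
   / dfact (2 m) is at most 1 / 'C(m, a), and 'C(m, a) >= 'C(n, s) * 'C(m - n, a - s),
   where a - s >= 2, and even a - s >= 3 as soon as s >= 5. *)
Lemma dfact_split_bound n r s d k :
    2 < r -> r <= s -> s + s < n -> d <= r -> 9 < n -> ~~ odd (n * r) ->
    (k == 2) || ((k == 3) && (4 < s)) ->
  dfact (s * r + d) * dfact (n * r - (s * r + d)) * 'C(n, s) * n ^ k
    <= 8 ^ k * k`! * dfact (n * r).
Proof.
move=> r3 rs sn dr n10 nr_even hk.
have [od|] := boolP (odd (s * r + d)); first by rewrite dfact_odd.
rewrite -(odd_double_half (n * r)) (negPf nr_even) add0n.
set m := (n * r)./2 => ev; rewrite -(odd_double_half (s * r + d)) (negPf ev) add0n.
set a := (s * r + d)./2.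
have Em : m.*2 = n * r by rewrite /m; lia.
have Ea : a.*2 = s * r + d by rewrite /a; lia.
have am : a <= m by rewrite -leq_double Em Ea; nia.
have sa : s <= a by rewrite -leq_double Ea; nia.
have nm : n <= m by rewrite -leq_double Em; nia.
have hq : a - s <= m - n by nia.
(* Twice the difference is (n - s)(r - 2) - d >= n - s - 3, while n - s > n / 2 and n >= 10. *)
have q8 : n <= 8 * (m - n - (a - s)) by nia.
(* 2(a - s) = s(r - 2) + d is even and at least s. *)
have kh : k <= a - s.
  by case/orP: hk => [/eqP->|/andP[/eqP-> s5]]; nia.
rewrite -doubleB; have := dfact_bin a (m - a); rewrite subnKC // => main.
have vdm := leq_bin_mul n (m - n) s (a - s); rewrite !subnKC // in vdm.
have := leq_exp_bin (m - n - (a - s)) kh; rewrite subnK // => bnd.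
have nk : n ^ k <= 8 ^ k * (m - n - (a - s)) ^ k by rewrite -expnMn leq_exp2r //; lia.
move: (dfact a.*2) (dfact (m - a).*2) (dfact m.*2) main => A B M main.
apply: (@leq_trans (A * B * 'C(n, s) * (8 ^ k * ('C(m - n, a - s) * k`!)))).
  by rewrite leq_mul2l (leq_trans nk) ?orbT // leq_mul2l bnd orbT.
apply: (@leq_trans (8 ^ k * k`! * (A * B * ('C(n, s) * 'C(m - n, a - s))))).
  move: 'C(n, s) 'C(m - n, a - s) (8 ^ k) (k`!) => x y z t.
  by rewrite leq_eqVlt; apply/orP; left; apply/eqP; lia.
by rewrite leq_mul2l (leq_trans _ main) ?orbT // leq_mul2l vdm orbT.
Qed.

Section Separations.
Variables (V : finType) (r : nat).
Hypotheses (r3 : 2 < r) (V10 : 9 < #|V|) (Vr : ~~ odd (#|V| * r)).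
Local Notation D := (V * 'I_r)%type.
Implicit Types (f : {perm D}) (v : V) (S : {set V}) (Q : {set 'I_r})
  (E : {set {set V}}).
Local Notation pairings := (pairings V r).
Local Notation simple_pairings := (simple_pairings V r).

(** Take the smaller of the two sides left by a cut vertex [v]. It has at least [r] elements: the
    neighbours of any [x] in it lie in the side together with [v], and differ from [x]. *)
Lemma small_separation E : simple_graph E -> regular r E -> ~ two_connected E ->
  exists S v, [/\ separates E S v, r <= #|S| & #|S| + #|S| < #|V|].
Proof.
move=> /forall_inP sE /forallP rE nE2.
have adj_irr x : adj E x x = false.
  by apply/negP=> /sE; rewrite cards2 eqxx.
have big S v : separates E S v -> S != set0 -> r <= #|S|.
  case/andP=> vS /forall_inP SP /set0Pn[x xS].
  have xv : x != v by apply: contraTneq xS => ->.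
  have xvS : x \in v |: S by rewrite !inE xS orbT.
  have : #|v |: S| = #|S|.+1 by rewrite cardsU1 vS.
  rewrite (cardsD1 x) xvS => -[<-]; rewrite -(eqP (rE x)).
  apply/subset_leq_card/fintype.subsetP=> y; rewrite !inE => xy.
  apply/andP; split; first by apply: contraTneq xy => ->; rewrite adj_irr.
  by have := forallP (SP x xS) y; rewrite xy !inE.
have [/existsP[S /existsP[v /and3P[sepS S0 ST]]]|none] := boolP
    [exists S, exists v, [&& separates E S v, S != set0 & v |: S != setT]]; last first.
  case: nE2; apply: two_connected_no_separation => S v sepS.
  have [S0|S0] := eqVneq S set0; [by left | right].
  apply: contraNeq none => ST; apply/existsP; exists S; apply/existsP; exists v.
  by rewrite sepS S0.
have [vS /forall_inP SP] := andP sepS.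
pose T := ~: (v |: S).
have cT : #|S| + #|T| < #|V|.
  by rewrite -(cardsC (v |: S)) cardsU1 vS ltn_add2r.
have sepT : separates E T v.
  apply/andP; split; first by rewrite !inE eqxx.
  apply/forall_inP=> x; rewrite !inE negb_or => /andP[xv xS]; apply/forallP=> y.
  apply/implyP=> xy; rewrite !inE negb_or; case: (eqVneq y v) => //= yv.
  apply: contra xS => yS; have := forallP (SP y yS) x.
  by rewrite adjC xy !inE (negPf xv).
have T0 : T != set0 by apply: contraNneq ST => T0; rewrite -[_ |: _]setCK -/T T0 setC0.
have [ST'|/ltnW TS] := leqP #|S| #|T|.
  by exists S, v; split; rewrite ?(big S v) //; lia.
by exists T, v; split; rewrite ?(big T v) //; lia.
Qed.

(* The half-edges at S together with those at v indexed by Q. When v separates S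
   from the other vertices and Q indexes the half-edges from v to S, this set is
   a union of pairs. *)
Definition cut_points S v Q : {set D} :=
  [set x | (x.1 \in S) || ((x.1 == v) && (x.2 \in Q))].

Lemma card_cut_points S v Q : v \notin S ->
  #|cut_points S v Q| = #|S| * r + #|Q|.
Proof.
move=> vS; have -> : cut_points S v Q = setX S setT :|: setX [set v] Q.
  by apply/setP=> x; rewrite !inE andbT.
rewrite cardsU !cardsX cardsT card_ord cards1 mul1n [X in _ - X](_ : _ = 0) ?subn0 //.
apply/eqP; rewrite cards_eq0; apply/eqP/setP=> x; rewrite !inE andbT.
by case: eqVneq => [->|_]; rewrite ?(negPf vS) ?andbF.
Qed.

Definition stable f (W : {set D}) : bool := [forall x in W, f x \in W].

Lemma separates_stable f S v : f \in pairings -> separates (edges_of f) S v ->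
  stable f (cut_points S v [set i | (f (v, i)).1 \in S]).
Proof.
move=> fM /andP[vS /forall_inP SP]; have [ff _] := pairingsP f fM.
apply/forall_inP=> x; rewrite !inE => /orP[xS|/andP[/eqP xv fxS]]; last first.
  by rewrite -xv -surjective_pairing in fxS; rewrite fxS.
have /implyP := forallP (SP _ xS) (f x).1; rewrite adj_edges_of // !inE.
have -> : [exists i, (f (x.1, i)).1 == (f x).1].
  by apply/existsP; exists x.2; rewrite -surjective_pairing.
move=> /(_ isT); case: (eqVneq (f x).1 v) => [<- _|_ /= -> //].
by rewrite -surjective_pairing ff xS orbT.
Qed.

Lemma card_stable_cut S v Q k : v \notin S -> r <= #|S| -> #|S| + #|S| < #|V| ->
    (k == 2) || ((k == 3) && (4 < #|S|)) ->
  #|[set f in pairings | stable f (cut_points S v Q)]| * 'C(#|V|, #|S|) * #|V| ^ k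
    <= 8 ^ k * k`! * #|pairings|.
Proof.
move=> vS rS SV hk; have WD : cut_points S v Q \subset [set: D].
  by apply/fintype.subsetP=> x _; rewrite inE.
have dr : #|Q| <= r by rewrite -[X in _ <= X]card_ord max_card.
have := dfact_split_bound r3 rS SV dr V10 Vr hk.
rewrite card_matchings cardsT card_prod card_ord; apply: leq_trans.
rewrite !leq_mul2r; apply/orP; right; apply/orP; right.
apply: leq_trans (card_stable_matchings WD) _.
by rewrite cardsD setTI cardsT card_prod card_ord card_cut_points.
Qed.

Definition cut_pairings s : {set {perm D}} :=
  [set f in simple_pairings | [exists S : {set V}, exists v,
     (#|S| == s) && separates (edges_of f) S v]].

(** Union bound over [S], [v] and the half-edges from [v] to [S]: the number of sets [S] cancels the
    binomial coefficient, and the choice of [v] costs one power of [#|V|]. *)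
Lemma card_cut_pairings s k : r <= s -> s + s < #|V| ->
    (k == 2) || ((k == 3) && (4 < s)) ->
  #|cut_pairings s| * #|V| ^ k.-1 <= 2 ^ r * (8 ^ k * k`!) * #|pairings|.
Proof.
move=> rs sV hk; set c := 8 ^ k * k`! * #|pairings|.
have V0 : 0 < #|V| by apply: leq_trans V10.
pose P (t : {set V} * (V * {set 'I_r})) := (#|t.1| == s) && (t.2.1 \notin t.1).
pose F (t : {set V} * (V * {set 'I_r})) :=
  [set f in pairings | stable f (cut_points t.1 t.2.1 t.2.2)].
have sub : #|cut_pairings s| <= \sum_(t | P t) #|F t|.
  apply: leq_card_union => f /setIdP[fS /existsP[S /existsP[v /andP[Ss sepS]]]].
  have [fM _ _] := simple_pairingsP fS.
  exists (S, (v, [set i | (f (v, i)).1 \in S])).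
    by rewrite /P /= Ss; case/andP: sepS.
  by apply/setIdP; split=> //; apply: separates_stable.
have each t : P t -> #|F t| * 'C(#|V|, s) * #|V| ^ k <= c.
  by case/andP=> /eqP ts vt; rewrite -ts card_stable_cut ?ts.
have cP : #|P| <= 'C(#|V|, s) * (#|V| * 2 ^ r).
  have -> : #|P| = #|[set t | P t]| by apply: eq_card => t; rewrite inE.
  apply: (@leq_trans #|setX [set S : {set V} | #|S| == s] [set: V * {set 'I_r}]|).
    apply/subset_leq_card/fintype.subsetP=> t; rewrite !inE andbT.
    by case/andP.
  have setr : #|{: {set 'I_r}}| = 2 ^ r.
    by rewrite -cardsT -powersetT card_powerset cardsT card_ord.
  by rewrite cardsX cardsT card_prod setr card_draws.
have : #|cut_pairings s| * ('C(#|V|, s) * #|V| ^ k) <= #|P| * c.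
  apply: leq_trans (leq_mul sub (leqnn _)) _.
  rewrite big_distrl /= -sum_nat_const; apply: leq_sum => t Pt.
  by rewrite mulnA each.
move=> main; have {}main := leq_trans main (leq_mul cP (leqnn c)).
have C0 : 0 < 'C(#|V|, s) * #|V|.
  by rewrite muln_gt0 V0 bin_gt0 (leq_trans (leq_addr s s)) // ltnW.
have kE : #|V| ^ k = #|V| * #|V| ^ k.-1.
  by rewrite -expnS prednK //; case/orP: hk => [/eqP->|/andP[/eqP->]].
rewrite -(leq_pmul2l C0); move: main; rewrite kE /c.
move: 'C(_, _) (#|V| ^ k.-1) (8 ^ k * k`!) (2 ^ r) => x y z t.
by congr (is_true (_ <= _)); lia.
Qed.

Lemma card_pairings_not_2connected (B : {set {perm D}}) :
    (forall f, f \in B -> f \in simple_pairings /\ ~ two_connected (edges_of f)) ->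
  #|B| * #|V| <= 4000 * 2 ^ r * #|pairings|.
Proof.
move=> BP; pose P s := (r <= s) && (s + s < #|V|).
have sub : #|B| <= \sum_(s < #|V| | P s) #|cut_pairings s|.
  apply: leq_card_union => f /BP[fS nE2].
  have /andP[sE rE] := edges_of_regular fS.
  have [S [v [sepS rS SV]]] := small_separation sE rE nE2.
  have SV' : #|S| < #|V| by lia.
  exists (Ordinal SV'); first by rewrite /P rS.
  by apply/setIdP; split=> //; apply/existsP; exists S; apply/existsP; exists v; rewrite eqxx.
rewrite -(big_mkord P (fun s => #|cut_pairings s|)) in sub.
have V5 : 5 <= #|V| by lia.
rewrite (@big_cat_nat _ _ _ 5) //= in sub.
apply: leq_trans (leq_mul sub (leqnn _)) _; rewrite mulnDl.
(* Sizes below 5 are bounded with [k = 2], where 128 = 8^2 2!. Larger ones use [k = 3], where 3072 =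
   8^3 3! and the extra power of [#|V|] pays for the number of sizes. *)
apply: (@leq_trans (5 * (2 ^ r * 128 * #|pairings|) + 2 ^ r * 3072 * #|pairings|));
  last by lia.
apply: leq_add.
  rewrite big_distrl /= -[X in X * _]subn0 -sum_nat_const_nat big_mkcond.
  apply: leq_sum => s _; case: ifP => // /andP[rs sV].
  by have := @card_cut_pairings s 2 rs sV isT; rewrite expn1.
have V0 : 0 < #|V| by lia.
rewrite -(leq_pmul2r V0) -mulnA big_distrl /=.
apply: (@leq_trans (\sum_(5 <= s < #|V|) 2 ^ r * 3072 * #|pairings|)).
  rewrite big_mkcond big_nat [leqRHS]big_nat; apply: leq_sum => s /andP[s5 _].
  case: ifP => // /andP[rs sV].
  by have := @card_cut_pairings s 3 rs sV; rewrite s5 orbT mulnn => /(_ isT).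
by rewrite sum_nat_const_nat mulnC leq_mul2l leq_subr orbT.
Qed.

End Separations.

(** * Almost all regular graphs *)

Lemma regular_cfc2 r n (E : {set {set 'I_n}}) : 0 < r -> r.+1 < n -> 2 < n ->
  E \in regular_graphs r n -> two_connected E -> E \in regular_graphs_cfc2 r n.
Proof.
move=> r0 rn n2 EG E2; rewrite inE EG two_connected_connected ?card_ord //=.
have /andP[/forall_inP sE /forallP rE] : simple_graph E && regular r E by rewrite inE in EG.
pose v : 'I_n := Ordinal (leq_trans (isT : 0 < 3) n2).
have [u uv] : exists u, u \in [set u | adj E v u].
  by apply/set0Pn; rewrite -cards_eq0 (eqP (rE v)) -lt0n.
(* [v] and its [r] neighbours do not exhaust the vertices, so the graph is not complete. *)
have [w] : exists w, w \notin v |: [set u | adj E v u].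
  apply/existsP; rewrite -negb_forall; apply: contraL rn => /forallP vT.
  rewrite -leqNgt -[X in X <= _]card_ord -cardsT.
  apply: (@leq_trans #|v |: [set u | adj E v u]|).
    by apply/subset_leq_card/fintype.subsetP=> z _; apply: vT.
  by rewrite cardsU1 (eqP (rE v)) -add1n leq_add2r leq_b1.
rewrite !inE negb_or => /andP[wv vw]; rewrite inE in uv.
apply/eqP/(@cfc_two_connected _ E u v w E2) => //; last by rewrite eq_sym.
  by have := sE _ uv; rewrite cards2 eqSS eqb1 eq_sym.
by rewrite adjC.
Qed.

(** The exceptional proportion is O(1/n). Multiplied by (r!)^n, both numbers of graphs become
    numbers of simple pairings, so the bounds on pairings transfer. *)
Lemma card_regular_not_cfc2 r : 2 < r -> exists C N, forall n, N <= n ->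
  ~~ odd (r * n) -> 0 < #|regular_graphs r n| /\
  #|regular_graphs r n :\: regular_graphs_cfc2 r n| * n
    <= C * #|regular_graphs r n|.
Proof.
move=> r3; set K := 4 * r + 8 * r ^ 2.
pose c := 2 * (2 * (r.+1 * r)).+1 ^ K.
(* [c] bounds the ratio of all pairings to simple ones. In the threshold, the first summand leaves
   half of the half-edges usable for switching, and [r + 12] gives [r.+1 < n] and [9 < n]. *)
exists (4000 * 2 ^ r * c), (2 * (K + 4 * (r.+1 * r)) + r + 12) => n nN rn.
have r0 : 0 < r by lia.
have Vr : ~~ odd (#|'I_n| * r) by rewrite card_ord mulnC.
have V10 : 9 < #|'I_n| by rewrite card_ord; lia.
have P0 : 0 < #|pairings 'I_n r|.
  by rewrite card_matchings cardsT card_prod !card_ord dfact_even_gt0 // mulnC.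
have : #|pairings 'I_n r| <= c * #|simple_pairings 'I_n r|.
  apply: card_pairings_simple => //; rewrite card_prod !card_ord; first by nia.
  by move: nN; rewrite -/K; move: (K + _) => t nN; nia.
pose Bad := regular_graphs r n :\: regular_graphs_cfc2 r n.
have regP E : E \in regular_graphs r n -> simple_graph E && regular r E.
  by rewrite inE.
have := @card_graphs_pairings 'I_n r (regular_graphs r n) regP.
have := @card_graphs_pairings 'I_n r Bad.
set B := [set f in _ | _] => EB EG main.
have {}EB := EB (fun E => fun EBad => regP E (proj1 (setDP EBad))).
have : #|B| * #|'I_n| <= 4000 * 2 ^ r * #|pairings 'I_n r|.
  apply: card_pairings_not_2connected => // f /setIdP[fS /setDP[fG fN]].
  by split=> // E2; move/negP: fN; apply; apply: regular_cfc2 => //; lia.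
have eS : [set f in simple_pairings 'I_n r | edges_of f \in regular_graphs r n]
        = simple_pairings 'I_n r.
  apply/setP=> f; apply/setIdP/idP => [[]//|fS]; split=> //.
  by rewrite inE edges_of_regular.
rewrite eS in EG; rewrite card_ord -EB => BadP.
rewrite -EG in main.
have K0 : 0 < r`! ^ #|'I_n| by rewrite expn_gt0 fact_gt0.
split.
  by rewrite lt0n; apply: contraTneq main => ->; rewrite -ltnNge !mul0n muln0.
rewrite -(leq_pmul2r K0) mulnAC; apply: leq_trans BadP _.
by apply: leq_trans (leq_mul (leqnn _) main) _; rewrite !mulnA.
Qed.

Unset Implicit Arguments.
Import Order.TTheory GRing.Theory Num.Theory.
Import numFieldNormedType.Exports.
Local Open Scope classical_set_scope.
Local Open Scope ring_scope.

(* There is no r-regular graph on n vertices when r * n is odd, so n tends to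
   infinity among the integers with r * n even. *)
Theorem theorem1p6 (R : realType) (r : nat) (hr : (3 <= r)%N) :
  (#|regular_graphs_cfc2 r n|%:R / #|regular_graphs r n|%:R : R)
    @[n --> within [set n : nat | ~~ odd (r * n)] \oo] --> (1 : R).
Proof.
have [C [N bound]] := card_regular_not_cfc2 hr.
apply/cvgrPdist_le => e e0; rewrite near_withinE.
near=> n => /= rn.
have Nn : (N <= n)%N by near: n; exact: nbhs_infty_ge.
have n0 : (0 < n)%N by near: n; exact: nbhs_infty_gt.
have en : C%:R / e <= n%:R by near: n; exact: nbhs_infty_ger.
have [G0 bad] := bound n Nn rn.
have sub : (regular_graphs_cfc2 r n \subset regular_graphs r n)%SET.
  by apply/fintype.subsetP=> E /setIdP[].
move: (cardsID (regular_graphs_cfc2 r n) (regular_graphs r n)) bad.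
rewrite (finset.setIidPr sub).
move: #|_ :\: _| #|regular_graphs_cfc2 r n| #|regular_graphs r n| G0.
move=> b g G G0 eG; rewrite -eG in G0 * => bn.
have gb0 : 0 < (g + b)%N%:R :> R by rewrite ltr0n.
(* The distance to 1 is the exceptional proportion, at most C/n and hence at most [e] by [en]. *)
have -> : 1 - g%:R / (g + b)%N%:R = b%:R / (g + b)%N%:R :> R.
  by rewrite -[X in X - _](divff (lt0r_neq0 gb0)) -mulrBl natrD addrC addKr.
rewrite ger0_norm ?divr_ge0 // ler_pdivrMr //.
have nR : 0 < n%:R :> R by rewrite ltr0n.
rewrite -(ler_pM2r nR) -natrM.
apply: (@le_trans _ _ (C%:R * (g + b)%N%:R)); first by rewrite -natrM ler_nat.
by rewrite mulrAC ler_pM2r // -ler_pdivrMl // mulrC.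
Unshelve. all: by end_near.
Qed.
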